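(* In the non-relativistic limit, the equation of motion $$m\,\ddot x^\mu=e\,F^\mu{}_\nu\,\dot x^\nu-\tfrac23\,e^2\,\eta_{\rho\sigma}\ddot x^\rho\ddot x^\sigma\,\dot x^\mu$$ does not have pre-accelerated solutions of Dirac's type.
   Context: $m>0$ and $e\neq0$ are the mass and charge of a point particle in four-dimensional Minkowski spacetime $(M,\eta)$, $c=1$, and $F$ is the electromagnetic field. Dirac's test situation is an electric pulse $\vec E=(\kappa\,\delta(\tau),0,0)$, $\kappa$ a constant and $\delta$ the Dirac delta. For this pulse the non-relativistic limit of the equation of motion is the one-dimensional equation for the component $x$ in the direction of the pulse $a\,\ddot x=\kappa\,\delta(\tau)$, with $a=\frac{3m}{2e^2}$ (understood in the sense of distributions). A pre-accelerated solution of Dirac's type is a solution for this pulse that accelerates before the pulse acts, i.e. whose velocity $\dot x$ is not constant on $\tau<0$. *)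

(* Defs.v *)
From Stdlib Require Import Reals Lra Lia Arith.
From Coquelicot Require Import Coquelicot.
Open Scope R_scope.

(** Test functions and distributions on the real line *)

Record test_fun : Type := TestFun {
  tf :> R -> R;
  tf_smooth : forall (n : nat) (t : R), ex_derive_n tf n t;
  tf_compact : exists r : R, forall t : R, r < Rabs t -> tf t = 0
}.

Lemma Derive_n_Derive (f : R -> R) (n : nat) (t : R) :
  Derive_n (Derive f) n t = Derive_n f (S n) t.
Proof.
  change (Derive f) with (Derive_n f 1).
  rewrite Derive_n_comp. f_equal. lia.
Qed.

Lemma Derive_smooth (f : R -> R) :
  (forall (n : nat) (t : R), ex_derive_n f n t) ->
  forall (n : nat) (t : R), ex_derive_n (Derive f) n t.
Proof.
  intros Hf [|n] t; [exact I|].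
  apply ex_derive_ext with (f := Derive_n f (S n)).
  - intros s. symmetry. apply Derive_n_Derive.
  - exact (Hf (S (S n)) t).
Qed.

Lemma Derive_zero_outside (f : R -> R) (r : R) :
  (forall t : R, r < Rabs t -> f t = 0) ->
  forall t : R, r < Rabs t -> Derive f t = 0.
Proof.
  intros Hf t Ht.
  rewrite (Derive_ext_loc f (fun _ => 0)).
  - apply Derive_const.
  - assert (He : 0 < Rabs t - r) by lra.
    exists (mkposreal _ He). intros s Hs. apply Hf.
    change (Rabs (s - t) < Rabs t - r) in Hs.
    assert (H := Rabs_triang_inv t s).
    rewrite (Rabs_minus_sym t s) in H. lra.
Qed.

Definition tf_derive (phi : test_fun) : test_fun :=
  TestFun (Derive phi)
    (Derive_smooth phi (tf_smooth phi))
    (match tf_compact phi with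
     | ex_intro r Hr => ex_intro _ r (Derive_zero_outside phi r Hr)
     end).

(** Linearity is phrased through the pointwise values of [chi], so that it also
    says that a distribution depends only on the values of its argument.
    Continuity is the usual seminorm estimate on test functions supported in
    [[-r, r]]. *)
Record distribution : Type := Distribution {
  pairing :> test_fun -> R;
  pairing_linear : forall (a b : R) (phi psi chi : test_fun),
    (forall t : R, chi t = a * phi t + b * psi t) ->
    pairing chi = a * pairing phi + b * pairing psi;
  pairing_continuous : forall r : R, exists (C : R) (N : nat),
    forall phi : test_fun, (forall t : R, r < Rabs t -> phi t = 0) ->
    forall B : R,
      (forall (n : nat) (t : R), (n <= N)%nat -> Rabs (Derive_n phi n t) <= B) ->
      Rabs (pairing phi) <= C * B
}.

Definition dist_eq (S T : distribution) : Prop :=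
  forall phi : test_fun, S phi = T phi.

Definition dirac_delta : distribution.
Proof.
  refine (Distribution (fun phi => phi 0) _ _).
  - intros a b phi psi chi H. apply H.
  - intros r. exists 1, O. intros phi _ B HB.
    rewrite Rmult_1_l. exact (HB O 0 (le_n O)).
Defined.

Definition dist_scale (c : R) (T : distribution) : distribution.
Proof.
  refine (Distribution (fun phi => c * T phi) _ _).
  - intros a b phi psi chi H.
    rewrite (pairing_linear T a b phi psi chi H). ring.
  - intros r. destruct (pairing_continuous T r) as [C [N H]].
    exists (Rabs c * C), N. intros phi Hphi B HB.
    rewrite Rabs_mult, Rmult_assoc.
    apply Rmult_le_compat_l; [apply Rabs_pos|].
    exact (H phi Hphi B HB).
Defined.

Definition dist_derive (T : distribution) : distribution.
Proof.
  refine (Distribution (fun phi => - T (tf_derive phi)) _ _).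
  - intros a b phi psi chi H.
    rewrite (pairing_linear T a b (tf_derive phi) (tf_derive psi) (tf_derive chi)).
    + ring.
    + intros t. simpl.
      rewrite (Derive_ext _ _ t H).
      rewrite Derive_plus, !Derive_scal; [reflexivity| |];
        apply ex_derive_scal; [exact (tf_smooth phi 1 t)|exact (tf_smooth psi 1 t)].
  - intros r. destruct (pairing_continuous T r) as [C [N H]].
    exists C, (S N). intros phi Hphi B HB.
    rewrite Rabs_Ropp. apply H.
    + exact (Derive_zero_outside phi r Hphi).
    + intros n t Hn. simpl tf. rewrite Derive_n_Derive. apply HB. lia.
Defined.

(** For [U] open: the (closed) support of [phi] is contained in [U]. *)
Definition supported_in (U : R -> Prop) (phi : test_fun) : Prop :=
  forall t : R, ~ U t -> locally t (fun s => phi s = 0).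

(** On the open set [U], [T] is the regular distribution of the function [f]. *)
Definition equals_on (U : R -> Prop) (T : distribution) (f : R -> R) : Prop :=
  forall phi : test_fun, supported_in U phi ->
    is_RInt_gen (fun t => f t * phi t)
      (Rbar_locally m_infty) (Rbar_locally p_infty) (T phi).

(** Dirac's pulse *)

Definition pulse (kappa : R) : distribution := dist_scale kappa dirac_delta.

(** Non-relativistic limit of
      m x''^mu = e F^mu_nu x'^nu - (2/3) e^2 (x''.x'') x'^mu
    for the pulse E = (kappa delta, 0, 0), as an equation for the component [x]
    along the pulse: the term quadratic in the acceleration drops out, and
    dividing by 2 e^2 / 3 leaves a x'' = kappa delta with a = 3 m / (2 e^2);
    the remaining constant factors of the force are absorbed in kappa. *)
Definition accel_coeff (m e : R) : R := 3 * m / (2 * e ^ 2).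

Definition nonrel_solution (m e kappa : R) (x : distribution) : Prop :=
  dist_eq (dist_scale (accel_coeff m e) (dist_derive (dist_derive x)))
          (pulse kappa).

Definition velocity_constant_before (x : distribution) : Prop :=
  exists v : R, equals_on (fun t => t < 0) (dist_derive x) (fun _ => v).

Definition pre_accelerated_solution (m e kappa : R) (x : distribution) : Prop :=
  nonrel_solution m e kappa x /\ ~ velocity_constant_before x.

(* Main.v *)
(** Dividing the equation by [a <> 0], the velocity [u = x'] has a derivative
    that vanishes on the test functions supported in [t < 0].  Such a test
    function with integral zero is the derivative of another one, so [u] kills
    it; hence on [t < 0] the value of [u] depends only, and linearly, on the
    integral of the test function, i.e. [u] is a constant there. *)

Require Import Defs.
From Stdlib Require Import Reals Lra Classical.
From Coquelicot Require Import Coquelicot.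
Open Scope R_scope.

Lemma test_fun_continuous (phi : test_fun) (t : R) : continuous phi t.
Proof. apply @ex_derive_continuous. exact (tf_smooth phi 1 t). Qed.

Lemma test_fun_ex_RInt (phi : test_fun) (a b : R) : ex_RInt phi a b.
Proof.
  apply @ex_RInt_continuous. intros t _. apply test_fun_continuous.
Qed.

(** The radius in [tf_compact] may be negative. With [0 <= r] every point left of [- r] is negative,
    so its absolute value is known. *)
Lemma test_fun_support_nonneg (phi : test_fun) :
  exists r : R, 0 <= r /\ forall t : R, r < Rabs t -> phi t = 0.
Proof.
  destruct (tf_compact phi) as [r Hr].
  exists (Rmax 0 r). split; [apply Rmax_l|].
  intros t Ht. apply Hr. assert (H := Rmax_r 0 r). lra.
Qed.

Lemma RInt_zero_between (f : R -> R) (a b : R) :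
  (forall t : R, Rmin a b < t < Rmax a b -> f t = 0) -> RInt f a b = 0.
Proof.
  intros Hf. rewrite (RInt_ext f (fun _ => 0) a b Hf).
  rewrite RInt_const. apply Rmult_0_r.
Qed.

Lemma test_fun_RInt_widen (phi : test_fun) (r a b : R) :
  (forall t : R, r < Rabs t -> phi t = 0) -> a <= - r -> r <= b ->
  RInt phi a b = RInt phi (- r) r.
Proof.
  intros Hr Ha Hb.
  rewrite <- (RInt_Chasles phi a (- r) b) by apply test_fun_ex_RInt.
  rewrite <- (RInt_Chasles phi (- r) r b) by apply test_fun_ex_RInt.
  rewrite (RInt_zero_between phi a (- r)), (RInt_zero_between phi r b).
  - unfold plus; simpl. ring.
  - intros t. rewrite Rmin_left, Rmax_right by lra. intros Ht.
    apply Hr. assert (H := Rle_abs t). lra.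
  - intros t. rewrite Rmin_left, Rmax_right by lra. intros Ht.
    apply Hr. assert (H := Rle_abs (- t)). rewrite Rabs_Ropp in H. lra.
Qed.

(** The limit is attained: once both endpoints lie beyond the support, the integral no longer
    changes. *)
Lemma test_fun_is_RInt_gen (phi : test_fun) (r : R) :
  (forall t : R, r < Rabs t -> phi t = 0) ->
  is_RInt_gen phi (Rbar_locally m_infty) (Rbar_locally p_infty)
    (RInt phi (- r) r).
Proof.
  intros Hr P HP.
  apply (Filter_prod _ _ _ (fun a => a < - r) (fun b => r < b)).
  - exists (- r). intros a Ha. exact Ha.
  - exists r. intros b Hb. exact Hb.
  - intros a b Ha Hb. exists (RInt phi a b). split.
    + apply (RInt_correct phi). apply test_fun_ex_RInt.
    + rewrite (test_fun_RInt_widen phi r) by (assumption || lra).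
      exact (locally_singleton _ P HP).
Qed.

Lemma test_fun_ex_RInt_gen (phi : test_fun) :
  exists l : R,
    is_RInt_gen phi (Rbar_locally m_infty) (Rbar_locally p_infty) l.
Proof.
  destruct (tf_compact phi) as [r Hr].
  exists (RInt phi (- r) r). exact (test_fun_is_RInt_gen phi r Hr).
Qed.

Lemma test_fun_linear_combination (a b : R) (phi psi : test_fun) :
  exists chi : test_fun, forall t : R, chi t = a * phi t + b * psi t.
Proof.
  assert (Hs : forall n t, ex_derive_n (fun t => a * phi t + b * psi t) n t).
  { intros n t. apply ex_derive_n_plus;
      (* [ex_derive_n_plus] asks for the derivatives on a neighbourhood; they exist everywhere, so
         any radius serves. *)
      exists posreal_one; intros s _ k _; apply ex_derive_n_scal_l;
      apply tf_smooth. }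
  assert (Hc : exists r, forall t, r < Rabs t -> a * phi t + b * psi t = 0).
  { destruct (tf_compact phi) as [r Hr]. destruct (tf_compact psi) as [q Hq].
    exists (Rmax r q). intros t Ht.
    assert (H1 := Rmax_l r q). assert (H2 := Rmax_r r q).
    rewrite Hr, Hq by lra. ring. }
  exists (TestFun _ Hs Hc). reflexivity.
Qed.

Lemma supported_in_linear_combination (U : R -> Prop) (a b : R)
  (phi psi chi : test_fun) :
  (forall t : R, chi t = a * phi t + b * psi t) ->
  supported_in U phi -> supported_in U psi -> supported_in U chi.
Proof.
  intros Hchi Hphi Hpsi t Ht.
  generalize (filter_and _ _ (Hphi t Ht) (Hpsi t Ht)).
  apply filter_imp. intros s [H1 H2]. rewrite Hchi, H1, H2. ring.
Qed.

(** The primitive started left of the support vanishes there; since the total integral is zero, it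
    vanishes again once the support has been passed, hence also near every point outside [t < b]. *)
Lemma test_fun_primitive (phi : test_fun) (b : R) :
  supported_in (fun t => t < b) phi ->
  is_RInt_gen phi (Rbar_locally m_infty) (Rbar_locally p_infty) 0 ->
  exists psi : test_fun,
    supported_in (fun t => t < b) psi /\ forall t : R, Derive psi t = phi t.
Proof.
  intros Hsupp Hint.
  destruct (test_fun_support_nonneg phi) as [r [Hr0 Hr]].
  assert (Htot : RInt phi (- r) r = 0).
  { rewrite <- (is_RInt_gen_unique _ _ (test_fun_is_RInt_gen phi r Hr)).
    exact (is_RInt_gen_unique _ _ Hint). }
  set (g := fun t => RInt phi (- r) t).
  assert (Hg : forall t, is_derive g t (phi t)).
  { intros t. apply (is_derive_RInt phi g (- r) t).
    - apply filter_forall. intros s.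
      apply (RInt_correct phi). apply test_fun_ex_RInt.
    - apply test_fun_continuous. }
  assert (HD : forall t, Derive g t = phi t).
  { intros t. apply is_derive_unique. apply Hg. }
  assert (Hs : forall n t, ex_derive_n g n t).
  (* From order two on, the derivatives of [g] are those of [phi] with the order lowered by one. *)
  { intros [|[|n]] t; [exact I|exists (phi t); apply Hg|].
    apply (ex_derive_ext (Derive_n phi n)).
    - intros s. rewrite <- (Derive_n_Derive g n).
      symmetry. apply Derive_n_ext. exact HD.
    - exact (tf_smooth phi (S n) t). }
  (* With zero total integral, [g s] is minus the integral of [phi] to the right of [s]. This gives
     both the compact support on the right and the support in [t < b]. *)
  assert (Hright : forall s, (forall t, s < t -> phi t = 0) -> g s = 0).
  { intros s Hz. unfold g. set (q := Rmax r s).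
    assert (H1 := Rmax_l r s). assert (H2 := Rmax_r r s). fold q in H1, H2.
    assert (H := RInt_Chasles phi (- r) s q
      (test_fun_ex_RInt _ _ _) (test_fun_ex_RInt _ _ _)).
    rewrite (RInt_zero_between phi s q) in H.
    - rewrite (test_fun_RInt_widen phi r (- r) q) in H by (assumption || lra).
      rewrite Htot in H. unfold plus in H; simpl in H. lra.
    - intros t. rewrite Rmin_left by lra. intros Ht. apply Hz. lra. }
  assert (Hc : exists q, forall t, q < Rabs t -> g t = 0).
  { exists r. intros t Ht. destruct (Rle_lt_dec 0 t) as [H0|H0].
    - apply Hright. intros s Hst. apply Hr.
      rewrite Rabs_pos_eq in Ht by lra.
      rewrite Rabs_pos_eq by lra. lra.
    - rewrite Rabs_left in Ht by lra. apply RInt_zero_between.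
      intros s. rewrite Rmin_right, Rmax_left by lra. intros Hst.
      apply Hr. rewrite Rabs_left by lra. lra. }
  exists (TestFun g Hs Hc). split; [|exact HD].
  (* For [s] near [t >= b], [phi] vanishes to the right of [s]: up to [t] by the choice of [eps],
     and from [t] on because these points lie outside [t < b]. *)
  intros t Ht. destruct (Hsupp t Ht) as [eps Heps].
  exists eps. intros s Hst. apply Hright. intros w Hw.
  destruct (Rle_lt_dec t w) as [Htw|Htw].
  - apply (locally_singleton w (fun s => phi s = 0)). apply Hsupp. lra.
  - apply Heps. change (Rabs (s - t) < eps) in Hst.
    change (Rabs (w - t) < eps).
    rewrite Rabs_left in Hst by lra. rewrite Rabs_left by lra. lra.
Qed.

Lemma dist_derive_zero_kills_mean_zero (T : distribution) (b : R) :
  (forall psi : test_fun, supported_in (fun t => t < b) psi ->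
     dist_derive T psi = 0) ->
  forall phi : test_fun, supported_in (fun t => t < b) phi ->
    is_RInt_gen phi (Rbar_locally m_infty) (Rbar_locally p_infty) 0 ->
    T phi = 0.
Proof.
  intros HT phi Hphi Hint.
  destruct (test_fun_primitive phi b Hphi Hint) as [psi [Hpsi HD]].
  assert (H := HT psi Hpsi). simpl in H.
  (* [tf_derive psi] and [phi] agree only pointwise, as records they may differ; linearity with
     coefficients 1 and 0 transfers the value of [T]. *)
  rewrite (pairing_linear T 1 0 (tf_derive psi) phi phi).
  - lra.
  - intros t. simpl. rewrite HD. ring.
Qed.

Lemma dist_derive_zero_constant (T : distribution) (b : R) :
  (forall psi : test_fun, supported_in (fun t => t < b) psi ->
     dist_derive T psi = 0) ->
  exists v : R, equals_on (fun t => t < b) T (fun _ => v).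
Proof.
  intros HT.
  (* Excluded middle spares the construction of a bump function: if no test
     function has nonzero integral, the constant [0] will do. *)
  destruct (classic (exists (rho : test_fun) (l : R),
    supported_in (fun t => t < b) rho /\ l <> 0 /\
    is_RInt_gen rho (Rbar_locally m_infty) (Rbar_locally p_infty) l))
    as [[rho [l [Hrho [Hl Hlint]]]]|Hnone].
  (* Testing against [rho] forces this constant. *)
  - exists (T rho / l). intros phi Hphi.
    destruct (test_fun_ex_RInt_gen phi) as [k Hk].
    (* The coefficient makes the integral of [chi] equal to [k - (k / l) * l = 0]. *)
    destruct (test_fun_linear_combination 1 (- (k / l)) phi rho) as [chi Hchi].
    assert (Hchi0 : T chi = 0).
    { apply (dist_derive_zero_kills_mean_zero T b HT).
      - exact (supported_in_linear_combination _ _ _ _ _ _ Hchi Hphi Hrho).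
      - replace 0 with (plus (scal 1 k) (scal (- (k / l)) l))
          by (unfold plus, scal; simpl; unfold mult; simpl; field; exact Hl).
        apply (is_RInt_gen_ext (fun t =>
          plus (scal 1 (phi t)) (scal (- (k / l)) (rho t)))).
        + apply filter_forall. intros p t _. symmetry. apply Hchi.
        + apply @is_RInt_gen_plus; try apply _;
            apply @is_RInt_gen_scal; try apply _; assumption. }
    rewrite (pairing_linear T 1 (- (k / l)) phi rho chi Hchi) in Hchi0.
    replace (T phi) with (scal (T rho / l) k).
    + apply @is_RInt_gen_scal; try apply _. exact Hk.
    + unfold scal; simpl; unfold mult; simpl.
      replace (T phi) with (k / l * T rho) by lra. field. exact Hl.
  - exists 0. intros phi Hphi.
    destruct (test_fun_ex_RInt_gen phi) as [k Hk].
    assert (Hk0 : k = 0).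
    { apply NNPP. intros Hne. apply Hnone. exists phi, k. auto. }
    replace (T phi) with (scal 0 k).
    + apply @is_RInt_gen_scal; try apply _. exact Hk.
    + subst k. rewrite (dist_derive_zero_kills_mean_zero T b HT phi Hphi Hk).
      apply Rmult_0_r.
Qed.

Theorem proposition6p8 (m e kappa : R) (hm : 0 < m) (he : e <> 0) :
  ~ exists x : distribution, pre_accelerated_solution m e kappa x.
Proof.
  intros [x [Hsol Hnc]]. apply Hnc. apply dist_derive_zero_constant.
  intros psi Hpsi.
  (* The pulse sits at 0, which is outside the open half-line [t < 0], so it is not seen by
     [psi]. *)
  assert (Hpsi0 : psi 0 = 0).
  { apply (locally_singleton 0 (fun s => psi s = 0)). apply Hpsi. lra. }
  assert (Ha : accel_coeff m e <> 0).
  { unfold accel_coeff. assert (He := pow_nonzero e 2 he).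
    apply Rmult_integral_contrapositive_currified; [lra|].
    apply Rinv_neq_0_compat. lra. }
  assert (H : accel_coeff m e * dist_derive (dist_derive x) psi = kappa * psi 0)
    by exact (Hsol psi).
  rewrite Hpsi0, Rmult_0_r in H.
  destruct (Rmult_integral _ _ H) as [H0|H0]; [contradiction|exact H0].
Qed.
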